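(* Let $\Sigma$ be a finite simplicial complex on $[0,n]$ and $i\geqslant0$. Suppose that $U,V\in\mathcal{B}(\Sigma,i+1)$ are such that $U=U'\cap\Sigma_{i+1}$ and $V=V'\cap\Sigma_{i+1}$ for some $U',V'\in\mathcal{B}([0,n],i+1)$. Then $\operatorname{Sq}_i^U=\operatorname{Sq}_i^V$ as maps $H^p(\Sigma;\mathbb{Z}/2\mathbb{Z})\to H^{2p-i}(\Sigma;\mathbb{Z}/2\mathbb{Z})$.
   Context: Notation. $[0,n]=\{0,\dots,n\}$. $\binom{S}{k}$ is the set of $k$-element subsets of $S$; $|L|_{>a}=|\{l\in L:l>a\}|$. A finite simplicial complex on $[0,n]$ is a set $\Sigma$ of non-empty subsets of $[0,n]$ closed under taking non-empty subsets; $\Sigma_p=\{\sigma\in\Sigma:|\sigma|=p+1\}$. $C_\bullet(\Sigma;\mathbb{Z}/2\mathbb{Z})$ is the free $\mathbb{Z}/2\mathbb{Z}$-module on $\Sigma$ ($\Sigma_p$ in degree $p$) with $\partial\{v_0,\dots,v_q\}=\sum_{p=0}^q\{v_0,\dots,\hat v_p,\dots,v_q\}$ for $q\geqslant1$ and $\partial=0$ in degree $0$. $C^\bullet(\Sigma;\mathbb{Z}/2\mathbb{Z})$ is the dual cochain complex with $\delta(u)(c)=u(\partial c)$, and $H^\bullet(\Sigma;\mathbb{Z}/2\mathbb{Z})$ its cohomology. $\mathcal{B}(\Sigma,i+1)$ is the set of $\Sigma$-consistent subsets $U\subseteq\Sigma_{i+1}$: for every $M=\{m_0<\dots<m_{i+2}\}\in\Sigma_{i+2}$,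 the set of $K\in U$ with $K\subset M$ is a beginning or an ending segment (possibly empty or everything) of $M\setminus m_{i+2}<\dots<M\setminus m_1<M\setminus m_0$. $\mathcal{B}([0,n],i+1)$ is the set of consistent subsets of $\binom{[0,n]}{i+2}$, i.e. the same notion with all $M\in\binom{[0,n]}{i+3}$. The coproduct (mod 2). For $U\in\mathcal{B}(\Sigma,i+1)$, $\sigma\in\Sigma$ and $L\in\binom{\sigma}{i+1}$, let $A_L$ be the set of $a\in\sigma\setminus L$ such that either $L\cup\{a\}\in U$ and $|L|_{>a}$ is even, or $L\cup\{a\}\notin U$ and $|L|_{>a}$ is odd; let $B_L=\sigma\setminus(L\cup A_L)$. Over $\mathbb{Z}/2\mathbb{Z}$, $\Delta_i^U(\sigma)=\sum_{L\in\binom{\sigma}{i+1}}(L\cup A_L)\otimes(L\cup B_L)$. Cup-$i$ product and squares. For $u\in C^p$, $v\in C^q$, $u\smile_i^Uv\in C^{p+q-i}$ is defined by $(u\smile_i^Uv)(c)=(u\otimes v)\Delta_i^U(c)$. The function $\operatorname{Sq}_i^U\colon H^p(\Sigma;\mathbb{Z}/2\mathbb{Z})\to H^{2p-i}(\Sigma;\mathbb{Z}/2\mathbb{Z})$ is $[u]\mapsto[u\smile_i^Uu]$ (this is well defined). *)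

(* Defs.v *)
From HB Require Import structures.
From mathcomp Require Import all_boot all_order all_algebra zify.

Set Implicit Arguments.
Unset Strict Implicit.
Unset Printing Implicit Defensive.

Import Order.TTheory GRing.Theory Num.Theory.
Local Open Scope ring_scope.
Local Open Scope quotient_scope.

Notation freeF2 T := {ffun T -> ('F_2)^o}.

Section LinearExtension.
Variables (T : finType) (V : vectType 'F_2) (f : T -> V).

Definition lext_fun (c : freeF2 T) : V := \sum_t c t *: f t.

Fact lext_fun_linear : linear lext_fun.
Proof.
move=> a c d; rewrite /lext_fun scaler_sumr -big_split /=.
by apply: eq_bigr => t _; rewrite !ffunE scalerDl scalerA.
Qed.

HB.instance Definition _ :=
  GRing.isLinear.Build 'F_2 (freeF2 T) V *:%R lext_fun lext_fun_linear.

Definition lext : 'Hom(freeF2 T, V) := linfun lext_fun.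

End LinearExtension.

Record scomplex (n : nat) := SComplex {
  faces :> {set {set 'I_n.+1}};
  faces_neq0 : set0 \notin faces;
  faces_closed : forall s t : {set 'I_n.+1},
    s \in faces -> t \subset s -> t != set0 -> t \in faces }.

Fact full_neq0 n : set0 \notin [set s : {set 'I_n.+1} | s != set0].
Proof. by rewrite inE eqxx. Qed.

Fact full_closed n (s t : {set 'I_n.+1}) :
  s \in [set s : {set 'I_n.+1} | s != set0] -> t \subset s -> t != set0 ->
  t \in [set s : {set 'I_n.+1} | s != set0].
Proof. by rewrite !inE. Qed.

Definition full_complex n : scomplex n := SComplex (@full_neq0 n) (@full_closed n).

Definition dimfaces n (Sigma : scomplex n) (p : int) : {set {set 'I_n.+1}} :=
  [set s in Sigma | #|s|%:Z == p + 1].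

Definition simplex n (Sigma : scomplex n) := {s : {set 'I_n.+1} | s \in faces Sigma}.

HB.instance Definition _ n (Sigma : scomplex n) := Finite.on (simplex Sigma).
HB.instance Definition _ n (Sigma : scomplex n) :=
  SubType.copy (simplex Sigma) {s : {set 'I_n.+1} | s \in faces Sigma}.

Definition verts n (Sigma : scomplex n) (s : simplex Sigma) : {set 'I_n.+1} := sval s.

(* [enum M] lists M = {m_0 < ... < m_(i+2)} increasingly, so [facets M] is
   M \ m_(i+2) < ... < M \ m_0. *)
Definition facets n (M : {set 'I_n.+1}) : seq {set 'I_n.+1} :=
  [seq M :\ m | m <- rev (enum M)].

Definition consistent n (Sigma : scomplex n) (k : nat) (U : {set {set 'I_n.+1}}) : Prop :=
  U \subset dimfaces Sigma k /\
  forall M, M \in dimfaces Sigma k.+1 ->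
    exists j : nat, [set K in U | K \subset M] =i take j (facets M)
                 \/ [set K in U | K \subset M] =i drop j (facets M).

Notation chain Sigma := (freeF2 (simplex Sigma)).
Notation cochain Sigma := 'Hom(chain Sigma, ('F_2)^o).
(* The tensor square of a free module on X is the free module on X * X. *)
Notation chain2 Sigma := (freeF2 (simplex Sigma * simplex Sigma)%type).

Section Chains.
Variables (n : nat) (Sigma : scomplex n).
Implicit Types (L : {set 'I_n.+1}) (U : {set {set 'I_n.+1}}).

(* This is 0 when s is not a simplex of Sigma. *)
Definition gen (s : {set 'I_n.+1}) : chain Sigma := [ffun x => (verts x == s)%:R].

Definition tensor (c d : chain Sigma) : chain2 Sigma := [ffun x => c x.1 * d x.2].

(* In degree 0 the only face is empty, and [gen set0 = 0]. *)
Definition boundary : 'Hom(chain Sigma, chain Sigma) :=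
  lext (fun s : simplex Sigma => \sum_(v in verts s) gen (verts s :\ v)).

Definition delta_fun (u : cochain Sigma) : cochain Sigma := (u \o boundary)%VF.

Definition eval_fun (s : simplex Sigma) (u : cochain Sigma) : ('F_2)^o := u (gen (verts s)).

Fact delta_fun_linear : linear delta_fun.
Proof. by move=> a u v; rewrite /delta_fun comp_lfunDl comp_lfunZl. Qed.

HB.instance Definition _ := GRing.isLinear.Build 'F_2 _ _ *:%R delta_fun delta_fun_linear.

Fact eval_fun_linear s : linear (eval_fun s).
Proof. by move=> a u v; rewrite /eval_fun !lfunE /= lfunE. Qed.

HB.instance Definition _ s :=
  GRing.isLinear.Build 'F_2 _ _ *:%R (eval_fun s) (eval_fun_linear s).

Definition delta : 'End(cochain Sigma) := linfun delta_fun.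

(* Degrees are integers, so that 2 * p - i below is not truncated. *)
Definition Cp (p : int) : {vspace cochain Sigma} :=
  (\bigcap_(s : simplex Sigma | verts s \notin dimfaces Sigma p) lker (linfun (eval_fun s)))%VS.

Definition Zp (p : int) : {vspace cochain Sigma} := (Cp p :&: lker delta)%VS.
Definition Bp (p : int) : {vspace cochain Sigma} := (delta @: Cp (p - 1))%VS.

Definition coboundaries (p : int) : {pred subvs_of (Zp p)} := [pred z | vsval z \in Bp p].
Arguments coboundaries p : clear implicits.

Fact coboundaries_zmod_closed p : zmod_closed (coboundaries p).
Proof.
by split=> [|x y]; rewrite !inE ?linear0 ?mem0v // linearB => hx hy; rewrite rpredB.
Qed.

HB.instance Definition _ p :=
  GRing.isZmodClosed.Build _ (coboundaries p) (coboundaries_zmod_closed p).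

Definition cohomology (p : int) := {ideal_quot (coboundaries p)}.

(* s is the ambient simplex sigma, on which A_L depends. *)
Definition Aset U (s : {set 'I_n.+1}) L : {set 'I_n.+1} :=
  [set a in s :\: L |
     ((a |: L \in U) && ~~ odd #|[set l in L | (a < l)%N]|)
  || ((a |: L \notin U) && odd #|[set l in L | (a < l)%N]|)].

Definition Bset U (s : {set 'I_n.+1}) L : {set 'I_n.+1} := s :\: (L :|: Aset U s L).

Definition coproduct (i : nat) U : 'Hom(chain Sigma, chain2 Sigma) :=
  lext (fun s : simplex Sigma =>
    \sum_(L : {set 'I_n.+1} | (L \subset verts s) && (#|L| == i.+1))
      tensor (gen (L :|: Aset U (verts s) L)) (gen (L :|: Bset U (verts s) L))).

Definition cotensor (u v : cochain Sigma) : 'Hom(chain2 Sigma, ('F_2)^o) :=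
  lext (fun x : simplex Sigma * simplex Sigma => u (gen (verts x.1)) * v (gen (verts x.2))).

Definition cup (i : nat) U (u v : cochain Sigma) : cochain Sigma :=
  (cotensor u v \o coproduct i U)%VF.

End Chains.

Arguments gen {n} Sigma s.
Arguments coboundaries {n} Sigma p.

Lemma addF2 (a : 'F_2) : a + a = 0.
Proof. by apply: val_inj; case: a => [[|[|?]] ?]. Qed.

Lemma addF2_eq0 (a b : 'F_2) : a + b = 0 -> a = b.
Proof. by move=> /(congr1 (+%R^~ b)); rewrite -addrA addF2 addr0 add0r. Qed.

Section Combinatorics.
Variable n : nat.
Local Notation T := 'I_n.+1.
Implicit Types (F G psi : {set T} -> 'F_2) (s K L M S : {set T}) (U : {set {set T}}).

Lemma sum_telescope (r : rel T) psi S :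
  {in S, forall a, ~~ r a a} ->
  {in S & &, forall b a c, r a b -> r b c -> r a c} ->
  {in S &, forall a b, a != b -> r a b (+) r b a} ->
  \sum_(x in S) (psi [set a in S | r a x] + psi (x |: [set a in S | r a x]))
  = psi set0 + psi S.
Proof.
have [m] := ubnP #|S|; elim: m S => // m IH S /ltnSE le_m irr tr tot.
have [->|/set0Pn[x0 x0S]] := eqVneq S set0; first by rewrite big_set0 addF2.
have [y /= yS ymax] := @arg_maxnP _ x0 (mem S) (fun x => #|[set a in S | r a x]|) x0S.
have {}yS : y \in S := yS.
have low a : a \in S -> a != y -> r a y.
  move=> aS ay; have := tot _ _ aS yS ay; case ray: (r a y) => //= rya.
  have /= := ymax _ aS; rewrite leqNgt => /negP[]; apply/proper_card/properP; split.
    apply/subsetP=> z; rewrite !inE => /andP[zS rzy]; rewrite zS /=.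
    exact: tr rya.
  by exists y; rewrite !inE yS //= irr.
have lowS : [set a in S | r a y] = S :\ y.
  apply/setP=> a; rewrite !inE; case: eqP => [->|/eqP ay] /=.
    by rewrite (negPf (irr _ yS)) andbF.
  by case aS: (a \in S) => //=; rewrite low.
rewrite (big_setD1 y) //= lowS setD1K //.
transitivity (psi (S :\ y) + psi S + (psi set0 + psi (S :\ y))).
  congr (_ + _); rewrite -[RHS]IH.
  - apply: eq_bigr => x; rewrite !inE => /andP[xy xS].
    suff -> : [set a in S | r a x] = [set a in S :\ y | r a x] by [].
    apply/setP=> a; rewrite !inE; case: eqP => [->|] //=.
    have := tot _ _ xS yS xy; rewrite low //= => /negPf ->.
    by rewrite andbF.
  - by rewrite (leq_trans _ le_m) // [X in (_ < X)%N](cardsD1 y) yS.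
  - by move=> a; rewrite inE => /andP[_]; apply: irr.
  - by move=> a b c; rewrite !inE => /andP[_ +] /andP[_ +] /andP[_ +]; apply: tr.
  - by move=> a b; rewrite !inE => /andP[_ +] /andP[_ +]; apply: tot.
by rewrite [psi (S :\ y) + psi S]addrC addrACA addF2 addr0 addrC.
Qed.

Definition Dsum (k : nat) U F G s : 'F_2 :=
  \sum_(L : {set T} | (L \subset s) && (#|L| == k))
    F (L :|: Aset U s L) * G (L :|: Bset U s L).

Definition dsum F s : 'F_2 := \sum_(v in s) F (s :\ v).

Definition locally_consistent (k : nat) U s : Prop :=
  {in U, forall K, #|K| = k.+1} /\
  forall M a b c, M \subset s -> #|M| = k.+2 ->
    a \in M -> b \in M -> c \in M -> (a < b < c)%N ->
    (M :\ c \in U -> M :\ a \in U -> M :\ b \in U) /\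
    (M :\ b \in U -> (M :\ c \in U) || (M :\ a \in U)).

Lemma locally_consistent0 k s : locally_consistent k set0 s.
Proof.
split=> [K|M a b c _ _ _ _ _ _]; first by rewrite inE.
by rewrite !inE.
Qed.

Lemma Aset_mem U s K x a : x \notin K -> a \notin K -> a != x -> a \in s ->
  (a \in Aset U s (x |: K)) =
  odd #|[set l in K | (a < l)%N]| (+) ((a < x)%N (+) ([set a; x] :|: K \in U)).
Proof.
move=> xK aK ax aS; rewrite !inE aS (negPf ax) (negPf aK) /= setUA.
have -> : [set l in x |: K | (a < l)%N] =
   (if (a < x)%N then [set x] else set0) :|: [set l in K | (a < l)%N].
  apply/setP=> l; case: ifP => h; rewrite !inE; case: eqP => [->|] /=; rewrite ?h ?andbF //.
case: ifP => h; last by rewrite set0U; case: odd; case: (_ \in U).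
by rewrite cardsU1 inE (negPf xK) /=; case: odd; case: (_ \in U).
Qed.

Section Order.
Variables (k : nat) (U : {set {set T}}) (s K : {set T}).
Hypotheses (Uc : locally_consistent k.+1 U s) (Ks : K \subset s) (cK : #|K| = k).

Definition prec (a b : T) := (a < b)%N (+) ([set a; b] :|: K \in U).

Lemma precC a b : a != b -> prec a b (+) prec b a.
Proof.
rewrite /prec [[set b; a]]setUC.
by case: ltngtP => // [||/val_inj ->]; rewrite ?eqxx //; case: (_ \in U).
Qed.

Lemma prec_irr : {in s :\: K, forall a, ~~ prec a a}.
Proof.
move=> a; rewrite inE /prec ltnn /= => /andP[aK _]; apply/negP=> /(proj1 Uc).
by rewrite setUid cardsU1 aK cK; lia.
Qed.

Lemma prec_min : {in s :\: K & &, forall a b c : T,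
  (a < b)%N -> (a < c)%N -> prec a b -> prec b c -> prec c a -> False}.
Proof.
have key x y z : x \in s :\: K -> y \in s :\: K -> z \in s :\: K -> (x < y < z)%N ->
    (prec x y -> prec y z -> prec x z) /\ (prec z y -> prec y x -> prec z x).
  rewrite !inE => /andP[xK xs] /andP[yK ys] /andP[zK zs] /[dup] lt_xyz /andP[xy yz].
  have nxy : x != y by apply: contraTneq xy => ->; rewrite ltnn.
  have nyz : y != z by apply: contraTneq yz => ->; rewrite ltnn.
  have nxz : x != z by apply: contraTneq (ltn_trans xy yz) => ->; rewrite ltnn.
  pose M := [set x; y; z] :|: K.
  have Ms : M \subset s.
    apply/subsetP=> w; rewrite !inE -!orbA => /or4P[/eqP->|/eqP->|/eqP->|] //.
    exact: (subsetP Ks).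
  have cM : #|M| = k.+3.
    rewrite /M -!setUA !cardsU1 !inE cK.
    by rewrite (negPf xK) (negPf yK) (negPf zK) (negPf nxy) (negPf nxz) (negPf nyz).
  have Mx : M :\ x = [set y; z] :|: K.
    apply/setP=> w; rewrite !inE; case: eqP => [->|] //=.
    by rewrite (negPf nxy) (negPf nxz) (negPf xK).
  have My : M :\ y = [set x; z] :|: K.
    apply/setP=> w; rewrite !inE; case: eqP => [->|] //=.
      by rewrite [y == x]eq_sym (negPf nxy) (negPf nyz) (negPf yK).
    by rewrite orbF.
  have Mz : M :\ z = [set x; y] :|: K.
    apply/setP=> w; rewrite !inE; case: eqP => [->|] //=.
      by rewrite [z == x]eq_sym [z == y]eq_sym (negPf nxz) (negPf nyz) (negPf zK).
    by rewrite orbF.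
  have [] := (proj2 Uc) M x y z Ms cM _ _ _ lt_xyz; rewrite ?inE ?eqxx ?orbT //.
  rewrite Mx My Mz /prec [[set z; y]]setUC [[set y; x]]setUC [[set z; x]]setUC.
  rewrite xy yz (ltn_trans xy yz).
  have -> : (z < y)%N = false by rewrite ltnNge (ltnW yz).
  have -> : (y < x)%N = false by rewrite ltnNge (ltnW xy).
  have -> : (z < x)%N = false by rewrite ltnNge (ltnW (ltn_trans xy yz)).
  by do 3 case: (_ \in U) => //=; split; auto; move=> *; auto.
move=> a b c aS bS cS ab ac rab rbc rca.
have nca : c != a by apply: contraTneq ac => ->; rewrite ltnn.
case: (ltngtP b c) => [bc|cb|/val_inj e].
- have [h _] := key a b c aS bS cS (introT andP (conj ab bc)).
  by have := precC nca; rewrite rca (h rab rbc).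
- have [_ h] := key a c b aS cS bS (introT andP (conj ac cb)).
  have nab : a != b by apply: contraTneq ab => ->; rewrite ltnn.
  by have := precC nab; rewrite rab (h rbc rca).
- by move: rbc; rewrite e (negPf (prec_irr cS)).
Qed.

Lemma prec_trans : {in s :\: K & &, forall b a c, prec a b -> prec b c -> prec a c}.
Proof.
move=> b a c bS aS cS rab rbc.
have neq x y : x \in s :\: K -> prec x y -> x != y.
  by move=> xS; apply: contraTneq => <-; apply: prec_irr.
have nab := neq _ _ aS rab; have nbc := neq _ _ bS rbc.
have [e|nac] := eqVneq a c.
  by have := precC nab; rewrite rab [X in prec b X]e rbc.
have := precC nac; case: (prec a c) => //= rca.
have nlt x y : x != y -> (x < y)%N || (y < x)%N.
  by case: ltngtP => // /val_inj ->; rewrite eqxx.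
have [ab|ba] := orP (nlt _ _ nab); have [bc|cb] := orP (nlt _ _ nbc);
  have [ac|ca] := orP (nlt _ _ nac).
- by case: (prec_min aS bS cS ab ac rab rbc rca).
- by have := ltn_trans (ltn_trans ab bc) ca; rewrite ltnn.
- by case: (prec_min aS bS cS ab ac rab rbc rca).
- by case: (prec_min cS aS bS ca cb rca rab rbc).
- by case: (prec_min bS cS aS bc ba rbc rca rab).
- by case: (prec_min bS cS aS bc ba rbc rca rab).
- by have := ltn_trans (ltn_trans cb ba) ac; rewrite ltnn.
- by case: (prec_min cS aS bS ca cb rca rab rbc).
Qed.

Lemma sum_flips F G :
  \sum_(x in s :\: K)
    (F (K :|: Aset U s (x |: K)) * G (x |: K :|: Bset U s (x |: K)) +
     F (x |: K :|: Aset U s (x |: K)) * G (K :|: Bset U s (x |: K)))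
  = F (K :|: Aset set0 s K) * G (K :|: Bset set0 s K) +
    G (K :|: Aset set0 s K) * F (K :|: Bset set0 s K).
Proof.
pose O := Aset set0 s K.
pose sd (S : {set T}) := [set a in s :\: K | (a \in O) (+) (a \in S)].
pose psi S := F (K :|: sd S) * G (K :|: ((s :\: K) :\: sd S)).
have OE a : a \in s :\: K -> (a \in O) = odd #|[set l in K | (a < l)%N]|.
  by rewrite !inE => /andP[/negPf -> ->] /=.
have OsK : O \subset s :\: K by apply/subsetP=> a; rewrite inE => /andP[].
have sd0 : sd set0 = O.
  apply/setP=> a; rewrite inE [a \in set0]inE addbF andb_idl //.
  exact: (subsetP OsK).
have sdT : sd (s :\: K) = (s :\: K) :\: O.
  apply/setP=> a; rewrite in_set [RHS]in_setD andbC.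
  by case: (a \in O) (a \in s :\: K) => [] [].
transitivity (psi set0 + psi (s :\: K)); last first.
  rewrite /psi sd0 sdT setDDr setDv set0U (setIidPr OsK) setDDl -/(Bset set0 s K).
  by rewrite [X in _ + X]mulrC.
rewrite -(@sum_telescope prec psi (s :\: K)); last first.
- by move=> a b _ _; apply: precC.
- exact: prec_trans.
- exact: prec_irr.
apply: eq_bigr => x xS; have := xS; rewrite inE => /andP[xK xs].
pose P := [set a in s :\: K | prec a x].
have AE a : a \in s :\: K -> a != x -> (a \in Aset U s (x |: K)) = (a \in sd P).
  move=> aS ax; have := aS; rewrite inE => /andP[aK as_].
  by rewrite (Aset_mem _ xK aK ax as_) [in RHS]inE aS /= OE // inE aS.
have xA : x \notin Aset U s (x |: K) by rewrite !inE eqxx.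
have xB : x \notin Bset U s (x |: K) by rewrite !inE eqxx.
have BE a : a \in s :\: K -> a != x -> (a \in Bset U s (x |: K)) = (a \notin sd P).
  move=> aS ax; rewrite -AE // in_setD in_setU in_setU1 (negPf ax).
  by move: aS; rewrite in_setD => /andP[/negPf -> ->]; rewrite andbT.
have xP : x \notin P by rewrite inE (negPf (prec_irr xS)) andbF.
have mem_out a : a \notin s :\: K -> a \notin K ->
   (a \in Aset U s (x |: K) = false) /\ (a \in Bset U s (x |: K) = false).
  by rewrite inE => + aK; rewrite aK /= => /negPf as_; rewrite !inE as_ !andbF.
have sdx a (S : {set T}) : (a \in sd S) = (a \in s :\: K) && ((a \in O) (+) (a \in S)).
  by rewrite inE.
have E (Q : {set T}) (C : {set T}) : {in s :\: K, Q =i C} -> (forall a, a \notin s :\: K ->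
   a \notin K -> (a \in Q) = (a \in C)) -> K :|: Q = K :|: C.
  move=> h1 h2; apply/setP=> a; rewrite ![in LHS]inE ![in RHS]inE.
  have [//|aK] := boolP (a \in K); have [aS|aS] := boolP (a \in s :\: K).
    by rewrite (h1 _ aS).
  by rewrite (h2 _ aS).
have e1 (S : {set T}) : (forall a, a != x -> (a \in S) = (a \in P)) -> x \notin sd S ->
    K :|: sd S = K :|: Aset U s (x |: K) /\
    K :|: ((s :\: K) :\: sd S) = x |: K :|: Bset U s (x |: K).
  move=> SP xsd; split.
    apply: E => a aS; last by move=> aK; rewrite (mem_out _ aS aK).1 sdx (negPf aS).
    have [->|ax] := eqVneq a x; first by rewrite (negPf xsd) (negPf xA).
    by rewrite AE // !sdx SP.
  rewrite -setUA setUCA; apply: E => a aS.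
    rewrite in_setU1; have [->|ax] := eqVneq a x; first by rewrite in_setD xsd xS.
    by rewrite BE // in_setD aS andbT !sdx SP.
  move=> aK; have ax : a != x by apply: contraNneq aS => ->.
  by rewrite in_setD (negPf aS) andbF in_setU1 (negPf ax) (mem_out _ aS aK).2.
have e2 (S : {set T}) : (forall a, a != x -> (a \in S) = (a \in P)) -> x \in sd S ->
    K :|: sd S = x |: K :|: Aset U s (x |: K) /\
    K :|: ((s :\: K) :\: sd S) = K :|: Bset U s (x |: K).
  move=> SP xsd; split.
    rewrite -setUA setUCA; apply: E => a aS.
      rewrite in_setU1; have [->|ax] := eqVneq a x; first by rewrite xsd.
      by rewrite AE // !sdx SP.
    move=> aK; have ax : a != x by apply: contraNneq aS => ->.
    by rewrite sdx (negPf aS) in_setU1 (negPf ax) (mem_out _ aS aK).1.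
  apply: E => a aS.
    have [->|ax] := eqVneq a x; first by rewrite in_setD xsd (negPf xB).
    by rewrite BE // in_setD aS andbT !sdx SP.
  by move=> aK; rewrite in_setD (negPf aS) andbF (mem_out _ aS aK).2.
have hP a : a != x -> (a \in P) = (a \in P) by [].
have hxP a : a != x -> (a \in x |: P) = (a \in P) by rewrite in_setU1 => /negPf ->.
rewrite -/P /psi; case xO: (x \in O).
  have h1 : x \notin sd (x |: P) by rewrite sdx xO setU11 andbF.
  have h2 : x \in sd P by rewrite sdx xS xO (negPf xP).
  by have [-> ->] := e1 _ hxP h1; have [-> ->] := e2 _ hP h2; rewrite addrC.
have h1 : x \notin sd P by rewrite sdx xO (negPf xP) andbF.
have h2 : x \in sd (x |: P) by rewrite sdx xS xO setU11.
by have [-> ->] := e1 _ hP h1; have [-> ->] := e2 _ hxP h2.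
Qed.
End Order.

Lemma Dsum_eq k U F G s : locally_consistent k.+1 U s ->
  \sum_(x in s) Dsum k.+1 U F G (s :\ x) + Dsum k.+1 U (dsum F) G s +
    Dsum k.+1 U F (dsum G) s
  = Dsum k set0 F G s + Dsum k set0 G F s.
Proof.
move=> Uc.
pose Q (L : {set T}) := (L \subset s) && (#|L| == k.+1).
pose f (L : {set T}) x := F ((L :|: Aset U s L) :\ x) * G (L :|: Bset U s L).
pose g (L : {set T}) x := F (L :|: Aset U s L) * G ((L :|: Bset U s L) :\ x).
have disA (L : {set T}) : [disjoint L & Aset U s L].
  by rewrite disjoint_sym; apply/pred0P=> x; rewrite /= !inE; case: (x \in L); rewrite ?andbF.
have disB (L : {set T}) : [disjoint L & Bset U s L].
  by rewrite disjoint_sym; apply/pred0P=> x; rewrite /= !inE; case: (x \in L); rewrite ?andbF.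
have disAB (L : {set T}) : [disjoint Aset U s L & Bset U s L].
  by rewrite disjoint_sym; apply/pred0P=> x; rewrite /= [x \in Bset _ _ _]inE in_setU negb_or -andbA; case: (x \in Aset U s L); rewrite ?andbF.
have dF : Dsum k.+1 U (dsum F) G s =
    \sum_(L | Q L) (\sum_(x in L) f L x + \sum_(x in Aset U s L) f L x).
  apply: eq_bigr => L _; rewrite /dsum mulr_suml.
  by rewrite (eq_bigl [predU L & Aset U s L]) ?bigU // => x; rewrite !inE.
have dG : Dsum k.+1 U F (dsum G) s =
    \sum_(L | Q L) (\sum_(x in L) g L x + \sum_(x in Bset U s L) g L x).
  apply: eq_bigr => L _; rewrite /dsum mulr_sumr.
  by rewrite (eq_bigl [predU L & Bset U s L]) ?bigU // => x; rewrite !inE.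
have Asx (L : {set T}) x : Aset U (s :\ x) L = Aset U s L :\ x.
  by apply/setP=> a; rewrite !inE; case: (a == x); rewrite ?andbF ?andbT.
have Bsx (L : {set T}) x : x \notin L -> x \in s ->
    Bset U (s :\ x) L = Bset U s L :\ x.
  move=> xL xs; apply/setP=> a; rewrite /Bset Asx in_setD1 !in_setD !in_setU !in_setD1 ?in_set1.
  by case: (a == x); rewrite /= ?andbF.
have dd : \sum_(x in s) Dsum k.+1 U F G (s :\ x) =
    \sum_(L | Q L) (\sum_(x in Aset U s L) f L x + \sum_(x in Bset U s L) g L x).
  rewrite /Dsum (exchange_big_dep Q) /=; last first.
    by move=> x L xs /andP[/subsetD1P[Ls _] cL]; rewrite /Q Ls cL.
  apply: eq_bigr => L /andP[Ls cL].
  rewrite (eq_bigl [predU Aset U s L & Bset U s L]) => [|x]; last first.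
    rewrite cL andbT subsetD1 Ls /= [RHS](_ : _ = (x \in Aset U s L) || (x \in Bset U s L)) //.
    rewrite [x \in Bset _ _ _]in_setD in_setU.
    have [|_] := boolP (x \in Aset U s L); last by rewrite orbF /= andbC.
    by rewrite inE in_setD => /andP[/andP[-> ->]].
  rewrite bigU //=; congr (_ + _); apply: eq_bigr => x xA.
    have xL : x \notin L by move: xA; apply: contraL => /(disjointFr (disA L)) ->.
    have xs : x \in s by move: xA; rewrite !inE => /andP[/andP[]].
    have xB := disjointFr (disAB L) xA.
    rewrite Asx Bsx // /f; congr (F _ * G _).
      by apply/setP=> a; rewrite !in_setD1 !in_setU in_setD1; case: eqP => [->|] //=; rewrite (negPf xL).
    by congr (_ :|: _); apply/setP=> a; rewrite in_setD1; case: eqP => [->|] //=.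
  have xL : x \notin L by move: xA; apply: contraL => /(disjointFr (disB L)) ->.
  have xs : x \in s by move: xA; rewrite inE => /andP[].
  have xB := disjointFl (disAB L) xA.
  rewrite Asx Bsx // /f; congr (F _ * G _).
    by congr (_ :|: _); apply/setP=> a; rewrite in_setD1; case: eqP => [->|] //=.
  by apply/setP=> a; rewrite !in_setD1 !in_setU in_setD1; case: eqP => [->|] //=; rewrite (negPf xL).
have -> : \sum_(x in s) Dsum k.+1 U F G (s :\ x) + Dsum k.+1 U (dsum F) G s +
    Dsum k.+1 U F (dsum G) s = \sum_(L | Q L) \sum_(x in L) (f L x + g L x).
  rewrite dF dG dd -!big_split /=; apply: eq_bigr => L _.
  rewrite big_split /=.
  set a := \sum_(x in Aset _ _ _) _; set b := \sum_(x in Bset _ _ _) _.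
  set c := \sum_(x in L) f L x; set d := \sum_(x in L) g L x.
  by rewrite [c + a]addrC [a + b + _]addrACA addF2 add0r [d + b]addrC addrACA addF2 add0r.
pose P (K : {set T}) := (K \subset s) && (#|K| == k).
have -> : Dsum k set0 F G s + Dsum k set0 G F s =
    \sum_(K | P K) \sum_(x in s :\: K) (f (x |: K) x + g (x |: K) x).
  rewrite /Dsum -big_split /=; apply: eq_bigr => K /andP[Ks /eqP cK].
  rewrite -(sum_flips Uc Ks cK F G).
  apply: eq_bigr => x; rewrite inE => /andP[xK xs]; rewrite /f /g.
  have hA : x \notin Aset U s (x |: K) by rewrite !inE eqxx.
  have hB : x \notin Bset U s (x |: K) by rewrite !inE eqxx.
  by congr (F _ * _ + _ * G _); apply/setP=> a; rewrite !in_setU !in_setD1 !in_setU in_set1;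
    case: eqP => [->|] //=; rewrite (negPf xK) ?(negPf hA) ?(negPf hB).
rewrite !pair_big_dep /=.
rewrite (reindex_onto (fun p : {set T} * T => (p.2 |: p.1, p.2))
                      (fun p : {set T} * T => (p.1 :\ p.2, p.2))) /=; last first.
  by case=> L x /= /andP[_ xL]; rewrite setD1K.
apply: eq_bigl => -[K x] /=; rewrite /P /Q setU11 andbT in_setD.
rewrite xpair_eqE eqxx andbT subUset sub1set.
have [xK|xK] := boolP (x \in K); rewrite /= ?andbF.
  rewrite (_ : (_ == K) = false) ?andbF //; apply/negP=> /eqP e.
  by move: xK; rewrite -e !inE eqxx.
rewrite cardsU1 xK add1n eqSS setU1K // eqxx andbT.
by case: (x \in s); case: (K \subset s); case: (_ == k).
Qed.

End Combinatorics.

Lemma lextE (T : finType) (V : vectType 'F_2) (f : T -> V) c :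
  lext f c = \sum_t c t *: f t.
Proof. by rewrite /lext lfunE. Qed.

Section WellDefined.
Variables (n : nat) (Sigma : scomplex n).
Implicit Types (u v w : cochain Sigma) (s t L : {set 'I_n.+1}) (U : {set {set 'I_n.+1}}).

Definition ev u s : 'F_2 := u (gen Sigma s).

Lemma verts_inj : injective (@verts n Sigma).
Proof. exact: val_inj. Qed.

Lemma verts_in (x : simplex Sigma) : verts x \in faces Sigma.
Proof. exact: valP. Qed.

Lemma gen_notin s : s \notin faces Sigma -> gen Sigma s = 0.
Proof.
move=> sS; apply/ffunP=> x; rewrite !ffunE; case: eqP => // e.
by rewrite -e verts_in in sS.
Qed.

Lemma ev_notin u s : s \notin faces Sigma -> ev u s = 0.
Proof. by move=> sS; rewrite /ev gen_notin // linear0. Qed.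

Lemma ev0 u : ev u set0 = 0.
Proof. by rewrite ev_notin // faces_neq0. Qed.

Lemma simplexP s : s \in faces Sigma -> {x : simplex Sigma | verts x = s}.
Proof. by move=> sS; exists (exist _ s sS). Qed.

Lemma lext_gen (V : vectType 'F_2) (f : simplex Sigma -> V) x :
  lext f (gen Sigma (verts x)) = f x.
Proof.
rewrite lextE (bigD1 x) //= ffunE eqxx scale1r big1 ?addr0 // => y yx.
by rewrite ffunE (inj_eq verts_inj) (negPf yx) scale0r.
Qed.

Lemma chainE (c : chain Sigma) : c = \sum_x c x *: gen Sigma (verts x).
Proof.
have E x y : (c x *: gen Sigma (verts x)) y = c x * (y == x)%:R.
  by rewrite ffunE [gen _ _ _]ffunE (inj_eq verts_inj).
apply/ffunP=> y; rewrite [RHS]sum_ffunE [RHS](bigD1 y isT) [X in _ = X + _]E eqxx mulr1.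
by rewrite big1 ?addr0 // => x xy; rewrite E eq_sym (negPf xy) mulr0.
Qed.

Lemma cochainP u v : (forall x : simplex Sigma, ev u (verts x) = ev v (verts x)) -> u = v.
Proof.
move=> e; apply/lfunP=> c; rewrite [c]chainE !linear_sum /=.
by apply: eq_bigr => x _; rewrite !linearZ /=; congr (_ *: _); apply: e.
Qed.

Lemma evD u v s : ev (u + v) s = ev u s + ev v s.
Proof. by rewrite /ev lfunE. Qed.

Lemma ev_zero s : ev 0 s = 0.
Proof. by rewrite /ev lfunE. Qed.

Lemma addcc u : u + u = 0.
Proof. by apply: cochainP => x; rewrite evD addF2 ev_zero. Qed.

Lemma addc_eq0 u v : u + v = 0 -> u = v.
Proof. by move=> /(congr1 (+%R^~ v)); rewrite -addrA addcc addr0 add0r. Qed.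

Lemma ev_lext (f : simplex Sigma -> ('F_2)^o) x : ev (lext f) (verts x) = f x.
Proof. by rewrite /ev lext_gen. Qed.

Lemma cotensor_tensor u v c d : cotensor u v (tensor c d) = u c * v d.
Proof.
rewrite lextE [in RHS](chainE c) [in RHS](chainE d) !linear_sum /= mulr_suml.
transitivity (\sum_x \sum_y tensor c d (x, y) *: (ev u (verts x) * ev v (verts y) : ('F_2)^o)).
  by rewrite pair_big /=; apply: eq_bigr => -[x y] _.
apply: eq_bigr => x _; rewrite mulr_sumr; apply: eq_bigr => y _.
by rewrite [u (_ *: _)]linearZ [v (_ *: _)]linearZ /= ffunE /GRing.scale /= /ev mulrACA.
Qed.

Lemma ev_cup i U u v s : s \in faces Sigma ->
  ev (cup i U u v) s = Dsum i.+1 U (ev u) (ev v) s.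
Proof.
move=> /simplexP[x <-]; rewrite /ev /cup comp_lfunE lext_gen linear_sum /=.
by apply: eq_bigr => L _; rewrite cotensor_tensor.
Qed.

Lemma ev_delta u s : s \in faces Sigma -> ev (delta Sigma u) s = dsum (ev u) s.
Proof.
move=> /simplexP[x <-]; rewrite /delta lfunE /= /ev /delta_fun comp_lfunE.
by rewrite lext_gen linear_sum.
Qed.

Lemma dimfacesE s k : (s \in dimfaces Sigma k%:Z) = (s \in faces Sigma) && (#|s| == k.+1).
Proof. by rewrite inE; congr (_ && _); apply/eqP/eqP; lia. Qed.

Lemma index_facets (M : {set 'I_n.+1}) a b : a \in M -> b \in M -> (a < b)%N ->
  (index (M :\ b) (facets M) < index (M :\ a) (facets M) < size (facets M))%N.
Proof.
move=> aM bM ab.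
have inj : {in M &, injective (fun m => M :\ m)}.
  move=> x y xM yM e; apply/eqP; apply: contraT => xy.
  have := setD11 x M; rewrite e !inE xM andbT => /negbT; rewrite negbK => h.
  by rewrite h in xy.
have idx x : x \in M -> index (M :\ x) (facets M) = index x (rev (enum M)).
  move=> xM; rewrite /facets; have : {subset rev (enum M) <= M}.
    by move=> y; rewrite mem_rev mem_enum.
  elim: (rev (enum M)) => //= y r IH sub.
  have yM : y \in M by apply: sub; rewrite inE eqxx.
  rewrite (inj_in_eq inj) // IH // => z zr; apply: sub.
  by rewrite inE zr orbT.
rewrite !idx // size_map.
rewrite index_mem mem_rev mem_enum aM andbT.
have srt : sorted (fun x y : 'I_n.+1 => (y < x)%N) (rev (enum M)).
  rewrite rev_sorted /= [enum M](_ : _ = [seq x <- enum 'I_n.+1 | x \in M]); last first.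
    by rewrite enumT.
  apply: sorted_filter => [x y z|]; first exact: ltn_trans.
  have := iota_ltn_sorted 0 n.+1; rewrite -val_enum_ord sorted_map.
  by [].
rewrite ltnNge; apply/negP=> le.
have trg : transitive (fun x y : 'I_n.+1 => (y < x)%N).
  by move=> y x z xy yz; apply: ltn_trans yz xy.
have := @sorted_ltn_index _ _ trg _ srt a b.
rewrite !mem_rev !mem_enum => /(_ aM bM) h.
move: le; rewrite leq_eqVlt => /orP[/eqP e|/h]; last by lia.
have : nth a (rev (enum M)) (index a (rev (enum M))) =
       nth a (rev (enum M)) (index b (rev (enum M))) by rewrite e.
by rewrite !nth_index ?mem_rev ?mem_enum // => eab; move: ab; rewrite eab ltnn.
Qed.

Lemma consistent_local k U s : consistent Sigma k U -> s \in faces Sigma ->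
  locally_consistent k U s.
Proof.
move=> [Usub Ucons] sS; split=> [K KU|M a b c Ms cM aM bM cM' /andP[ab bc]].
  by have := subsetP Usub _ KU; rewrite dimfacesE => /andP[_ /eqP].
have MS : M \in dimfaces Sigma k.+1%:Z.
  rewrite dimfacesE cM eqxx andbT (faces_closed sS) //.
  by rewrite -card_gt0 cM.
have [j h] := Ucons M MS.
have [/andP[i1 i2] /andP[i3 i4]] := (index_facets aM bM ab, index_facets bM cM' bc).
have inU m : m \in M -> (M :\ m \in U) = (M :\ m \in [set K in U | K \subset M]).
  by move=> _; rewrite inE subD1set andbT.
have fM m : m \in M -> M :\ m \in facets M.
  by move=> mM; apply: map_f; rewrite mem_rev mem_enum.
have uf : uniq (facets M).
  rewrite map_inj_in_uniq ?rev_uniq ?enum_uniq // => x y.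
  rewrite !mem_rev !mem_enum => xM yM e; apply/eqP; apply: contraT => xy.
  have := setD11 x M; rewrite e !inE xM andbT => /negbT; rewrite negbK => hh.
  by rewrite hh in xy.
rewrite !inU //; case: h => h; rewrite !h.
  by rewrite !in_take ?fM //; split=> [_|lt_b]; [apply: ltn_trans i1|rewrite (ltn_trans i3 lt_b)].
have inD x : x \in facets M -> (x \in drop j (facets M)) = (j <= index x (facets M))%N.
  move=> xf; rewrite leqNgt -in_take //; have := xf; have := uf.
  rewrite -{1 2}[facets M](cat_take_drop j) cat_uniq mem_cat => /and3P[_ /hasPn dis _].
  by case xd: (x \in drop _ _); [rewrite (dis _ xd)|rewrite orbF => ->].
by rewrite !inD ?fM //; split=> [le_c _|le_b];
  [exact: leq_trans le_c (ltnW i3)|rewrite (leq_trans le_b (ltnW i1)) orbT].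
Qed.
Lemma Dsum_set0 k U (F G : {set 'I_n.+1} -> 'F_2) : Dsum k.+1 U F G set0 = 0.
Proof.
rewrite /Dsum big_pred0 // => L; rewrite subset0.
by case: eqP => [->|] //=; rewrite cards0.
Qed.

Lemma ev_cup0 i U u v s : (s \in faces Sigma) || (s == set0) ->
  ev (cup i U u v) s = Dsum i.+1 U (ev u) (ev v) s.
Proof.
case/orP=> [|/eqP->]; first exact: ev_cup.
by rewrite ev0 Dsum_set0.
Qed.

Lemma Dsum_dsuml k U u (G : {set 'I_n.+1} -> 'F_2) s : s \in faces Sigma ->
  Dsum k.+1 U (dsum (ev u)) G s = Dsum k.+1 U (ev (delta Sigma u)) G s.
Proof.
move=> sS; apply: eq_bigr => L /andP[Ls cL]; rewrite ev_delta //.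
apply: (faces_closed sS).
  by rewrite subUset Ls; apply/subsetP=> a; rewrite !inE => /andP[/andP[]].
by rewrite -card_gt0 (leq_trans _ (subset_leq_card (subsetUl _ _))) // (eqP cL).
Qed.

Lemma Dsum_dsumr k U (F : {set 'I_n.+1} -> 'F_2) v s : s \in faces Sigma ->
  Dsum k.+1 U F (dsum (ev v)) s = Dsum k.+1 U F (ev (delta Sigma v)) s.
Proof.
move=> sS; apply: eq_bigr => L /andP[Ls cL]; rewrite ev_delta //.
apply: (faces_closed sS).
  by rewrite subUset Ls subsetDl.
by rewrite -card_gt0 (leq_trans _ (subset_leq_card (subsetUl _ _))) // (eqP cL).
Qed.

(* For i > 0 this is the cup-(i-1) product of the empty consistent set. *)
Definition lowcup (i : nat) u v : cochain Sigma :=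
  lext (fun x : simplex Sigma => Dsum i set0 (ev u) (ev v) (verts x) : ('F_2)^o).

Lemma delta_cup i U u v : consistent Sigma i.+1 U ->
  delta Sigma (cup i U u v) + cup i U (delta Sigma u) v + cup i U u (delta Sigma v)
  = lowcup i u v + lowcup i v u.
Proof.
move=> Uc; apply: cochainP => x; have xS := verts_in x.
rewrite !evD !ev_lext -(Dsum_eq _ _ (consistent_local Uc xS)).
rewrite !ev_cup // Dsum_dsuml // Dsum_dsumr // ev_delta //; congr (_ + _ + _).
apply: eq_bigr => a ax; rewrite ev_cup0 //.
have [->|nz] := eqVneq (verts x :\ a) set0; first by rewrite orbT.
by rewrite (faces_closed xS) // subD1set.
Qed.

Lemma consistent_set0 k : consistent Sigma k set0.
Proof.
split=> [|M _]; first exact: sub0set.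
by exists 0; left=> K; rewrite take0 !inE.
Qed.

Lemma lowcup0 u v : lowcup 0 u v = 0.
Proof.
apply: cochainP => x; rewrite ev_lext ev_zero /Dsum big1 // => L /andP[_].
rewrite cards_eq0 => /eqP ->; rewrite (_ : Aset _ _ _ = set0) ?setU0 ?ev0 ?mul0r //.
apply/setP=> a; rewrite !inE /= (_ : [set l in set0 | _] = set0) ?cards0 ?andbF //.
by apply/setP=> l; rewrite !inE.
Qed.

Lemma lowcupS i u v : lowcup i.+1 u v = cup i set0 u v.
Proof. by apply: cochainP => x; rewrite ev_lext ev_cup // verts_in. Qed.

Lemma delta_lowcup i u : 
  delta Sigma (lowcup i u u) = lowcup i (delta Sigma u) u + lowcup i u (delta Sigma u).
Proof.
case: i => [|i]; first by rewrite !lowcup0 linear0 addr0.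
have := delta_cup u u (consistent_set0 i.+1).
by rewrite addcc !lowcupS -addrA => /addc_eq0.
Qed.

Lemma cupDl i U u u' v : cup i U (u + u') v = cup i U u v + cup i U u' v.
Proof.
apply: cochainP => x; have xS := verts_in x; rewrite evD !ev_cup // -big_split /=.
by apply: eq_bigr => L _; rewrite evD mulrDl.
Qed.

Lemma cupDr i U u v v' : cup i U u (v + v') = cup i U u v + cup i U u v'.
Proof.
apply: cochainP => x; have xS := verts_in x; rewrite evD !ev_cup // -big_split /=.
by apply: eq_bigr => L _; rewrite evD mulrDr.
Qed.

Lemma cup0l i U v : cup i U 0 v = 0.
Proof.
apply: cochainP => x; rewrite ev_cup ?verts_in // ev_zero.
by apply: big1 => L _; rewrite ev_zero mul0r.
Qed.

Lemma cup0r i U u : cup i U u 0 = 0.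
Proof.
apply: cochainP => x; rewrite ev_cup ?verts_in // ev_zero.
by apply: big1 => L _; rewrite ev_zero mulr0.
Qed.

Lemma memCp p u :
  reflect (forall s, s \notin dimfaces Sigma p -> ev u s = 0) (u \in Cp Sigma p).
Proof.
apply: (iffP idP) => [uC s sp|h].
  have [/simplexP[x e]|/ev_notin-> //] := boolP (s \in faces Sigma).
  have := subv_bigcapP uC x; rewrite e => /(_ sp).
  by rewrite -memvE memv_ker lfunE /= /eval_fun e => /eqP.
apply/subv_bigcapP=> x xp; rewrite -memvE memv_ker lfunE /=.
by apply/eqP; apply: h.
Qed.

Lemma Dsum_deg k U (p q : int) u v s : u \in Cp Sigma p -> v \in Cp Sigma q ->
  Dsum k U (ev u) (ev v) s != 0 -> #|s|%:Z = p + q - k%:Z + 2.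
Proof.
move=> /memCp uC /memCp vC.
apply: contraNeq => neq; apply/eqP; apply: big1 => L /andP[Ls /eqP cL].
have [/uC ->|] := boolP (L :|: Aset U s L \notin dimfaces Sigma p); first by rewrite mul0r.
have [/vC ->|] := boolP (L :|: Bset U s L \notin dimfaces Sigma q); first by rewrite mulr0.
rewrite !negbK !inE => /andP[_ /eqP cB] /andP[_ /eqP cA]; case/eqP: neq.
have LA : [disjoint L & Aset U s L].
  by rewrite disjoint_sym; apply/pred0P=> x; rewrite /= !inE; case: (x \in L); rewrite ?andbF.
have LAs : L :|: Aset U s L \subset s.
  by rewrite subUset Ls; apply/subsetP=> a; rewrite !inE => /andP[/andP[]].
have cB' : #|L :|: Bset U s L| = (k + #|Bset U s L|)%N.
  rewrite cardsU cL (_ : _ :&: _ = set0) ?cards0 ?subn0 //.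
  by apply/setP=> x; rewrite !inE; case: (x \in L).
have cs : #|s| = (#|L :|: Aset U s L| + #|Bset U s L|)%N.
  by rewrite /Bset cardsD (setIidPr LAs) subnKC // subset_leq_card.
by rewrite cB' in cB; rewrite cs; lia.
Qed.

Lemma cup_Cp i U p q u v : u \in Cp Sigma p -> v \in Cp Sigma q ->
  cup i U u v \in Cp Sigma (p + q - i%:Z).
Proof.
move=> uC vC; apply/memCp=> s.
have [sS|/ev_notin-> //] := boolP (s \in faces Sigma).
rewrite inE sS /= ev_cup // => sd; apply: contraNeq sd => nz.
by rewrite (Dsum_deg uC vC nz); apply/eqP; lia.
Qed.

Lemma lowcup_Cp i p q u v : u \in Cp Sigma p -> v \in Cp Sigma q ->
  lowcup i u v \in Cp Sigma (p + q - i%:Z + 1).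
Proof.
move=> uC vC; apply/memCp=> s.
have [/simplexP[x e]|/ev_notin-> //] := boolP (s \in faces Sigma).
rewrite -e ev_lext inE verts_in /= => sd; apply: contraNeq sd => nz.
by rewrite (Dsum_deg uC vC nz); apply/eqP; lia.
Qed.

Lemma cup_cocycle i U (Uc : consistent Sigma i.+1 U) p u :
  u \in Zp Sigma p -> cup i U u u \in Zp Sigma (2 * p - i%:Z).
Proof.
rewrite !memv_cap !memv_ker => /andP[uC /eqP du]; apply/andP; split.
  by rewrite (_ : 2 * p = p + p) ?cup_Cp //; lia.
by have := delta_cup u u Uc; rewrite du cup0l cup0r !addr0 addcc => ->.
Qed.

Lemma cup_coboundary i U (Uc : consistent Sigma i.+1 U) p u v :
  u \in Zp Sigma p -> v \in Zp Sigma p -> u - v \in Bp Sigma p ->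
  cup i U u u - cup i U v v \in Bp Sigma (2 * p - i%:Z).
Proof.
rewrite !memv_cap !memv_ker => /andP[uC /eqP du] /andP[vC /eqP dv].
move=> /memv_imgP[w wC e].
have ew : delta Sigma (delta Sigma w) = 0 by rewrite -e linearB /= du dv subr0.
have eC : delta Sigma w \in Cp Sigma p by rewrite -e rpredB.
have -> : u = v + delta Sigma w by rewrite -e addrC subrK.
set e1 := delta Sigma w in ew eC *.
have h1 := delta_cup v w Uc; have h2 := delta_cup w v Uc.
rewrite dv cup0l addr0 in h1; rewrite dv cup0r addr0 in h2.
have h3 := delta_cup w e1 Uc.
rewrite ew cup0r addr0 [X in _ = X]addrC -delta_lowcup in h3.
apply/memv_imgP; exists (cup i U v w + cup i U w v + (cup i U w e1 + lowcup i w w)).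
  have E1 : 2 * p - i%:Z - 1 = p + (p - 1) - i%:Z by lia.
  have E2 : 2 * p - i%:Z - 1 = (p - 1) + p - i%:Z by lia.
  have E3 : 2 * p - i%:Z - 1 = (p - 1) + (p - 1) - i%:Z + 1 by lia.
  by rewrite !rpredD //; [rewrite E1|rewrite E2|rewrite E2|rewrite E3];
    rewrite ?cup_Cp ?lowcup_Cp.
have solve (a b c : cochain Sigma) : a + b = c -> b = a + c by move=> <-; rewrite addrA addcc add0r.
rewrite !linearD /= -h3 [X in _ = _ + X]addrA addcc add0r.
rewrite cupDl !cupDr (solve _ _ _ h1) (solve _ _ _ h2) [lowcup i w v + _]addrC.
set d1 := delta _ _; set d2 := delta _ _; set l := lowcup _ _ _ + _.
rewrite -[cup i U v v + _ + _]addrA addrAC subrr add0r addrA; congr (_ + _).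
by rewrite [d2 + l]addrC addrA -[d1 + l + l]addrA addcc addr0.
Qed.

End WellDefined.

Section Square.
Variables (n : nat) (Sigma : scomplex n) (i : nat) (U : {set {set 'I_n.+1}}).
Hypothesis Uc : consistent Sigma i.+1 U.
Variable p : int.

Definition cup_square (z : subvs_of (Zp Sigma p)) : subvs_of (Zp Sigma (2 * p - i%:Z)) :=
  Subvs (cup_cocycle Uc (subvsP z)).

Definition Sq (x : cohomology Sigma p) : cohomology Sigma (2 * p - i%:Z) :=
  \pi_(cohomology Sigma (2 * p - i%:Z)) (cup_square (repr x)).

(* Sq does not depend on the cocycle chosen to represent a class. *)
Lemma SqE z : Sq (\pi_(cohomology Sigma p) z) =
  \pi_(cohomology Sigma (2 * p - i%:Z)) (cup_square z).
Proof.
apply/eqP; rewrite /Sq -Quotient.idealrBE inE linearB /=.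
apply: cup_coboundary (subvsP _) (subvsP _) _ => //.
have : repr (\pi_(cohomology Sigma p) z) - z \in coboundaries Sigma p.
  by rewrite Quotient.idealrBE reprK.
by rewrite inE linearB.
Qed.

End Square.

(* Main.v *)
Require Import Defs.
From mathcomp Require Import all_boot all_order all_algebra.

(** For a fixed face [s], both coproducts solve the same equation
    [d D + D d = (1 + T) Delta_(i-1)], so that their difference mod 2 is a chain
    map carried by [s |-> C(s) (x) C(s)].  In the augmented complexes, where the
    empty set has degree [-1] and the coproducts vanish on it, coning off the
    left factor from a vertex of [s] contracts [C(s) (x) C(s)]; acyclic carriers
    then yield a chain homotopy from this difference to 0, and evaluating that
    homotopy on [u (x) u] for a cocycle [u] exhibits the difference of the two
    squares as a coboundary. *)

Set Implicit Arguments.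
Unset Strict Implicit.
Unset Printing Implicit Defensive.

Import GRing.Theory.
Local Open Scope ring_scope.

(** * Cones and the augmented coboundary *)

Section Homotopy.
Variable n : nat.
Local Notation T := 'I_n.+1.
Implicit Types (F G : {set T} -> 'F_2) (s t A : {set T}).

(** The transpose of joining with [v], where a degenerate join is 0. *)
Definition cone (v : T) F A : 'F_2 := if v \in A then 0 else F (v |: A).

(* Here [dsum] is the augmented coboundary, so no correction term occurs. *)
Lemma dsum_cone v F A : dsum (cone v F) A + cone v (dsum F) A = F A.
Proof.
rewrite /dsum /cone; have [vA|vA] := boolP (v \in A).
  rewrite addr0 (big_setD1 v) //= setD11 setD1K // big1 ?addr0 // => x.
  by rewrite !inE vA eq_sym => /andP[-> _].
rewrite (big_setU1 _ vA) /= setU1K // addrCA -big_split big1 /= ?addr0 // => x xA.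
have vx : v != x by apply: contraNneq vA => ->.
rewrite in_setD1 (negPf vA) andbF (_ : v |: A :\ x = (v |: A) :\ x) ?addF2 //.
by apply/setP=> y; rewrite !inE; case: (eqVneq y v) => [->|]; rewrite ?vx.
Qed.

(** Each pair of vertices is removed in both orders, so the terms cancel mod 2. *)
Lemma sum_setD1D1 (h : {set T} -> 'F_2) s :
  \sum_(x in s) \sum_(y in s :\ x) h (s :\ x :\ y) = 0.
Proof.
pose lt (x y : T) := (x < y)%N.
transitivity (\sum_(x in s) (\sum_(y in s | lt x y) h (s :\ x :\ y) +
                            \sum_(y in s | lt y x) h (s :\ x :\ y))).
  apply: eq_bigr => x xs; rewrite (bigID (lt x)) /=; congr (_ + _);
    apply: eq_bigl => y; rewrite in_setD1 /lt -val_eqE /=;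
    by case: (y \in s); rewrite ?andbF //=; case: ltngtP.
rewrite big_split /= [X in _ + X](exchange_big_dep (mem s)) /=; last by move=> x y _ /andP[].
rewrite -big_split big1 //= => x xs.
rewrite [X in _ + X](eq_bigr (fun y => h (s :\ x :\ y))); last first.
  by move=> y _; congr h; rewrite setDDl setUC -setDDl.
by rewrite [X in _ + X](eq_bigl (fun y => (y \in s) && lt x y)) ?addF2 // => y; rewrite xs.
Qed.

(** * Chain homotopies by acyclic carriers *)

Section Carrier.
(** [D F G s] stands for F (x) G evaluated on a chain D(s). Testing [F] and [G] only on subsets of
    [s] expresses that D(s) is carried by C(s) (x) C(s). *)
Variable D : ({set T} -> 'F_2) -> ({set T} -> 'F_2) -> {set T} -> 'F_2.
Hypothesis D_addl : forall F1 F2 F3 G s,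
  (forall A, A \subset s -> F3 A = F1 A + F2 A) -> D F3 G s = D F1 G s + D F2 G s.
Hypothesis D_0r : forall F G s, (forall A, A \subset s -> G A = 0) -> D F G s = 0.
Hypothesis D_set0 : forall F G, D F G set0 = 0.

(** Dual form of H(s) = (h_v (x) 1)(D(s) + H(ds)), where h_v is the join with [v]; [m] is fuel, to
    be taken equal to the cardinality of [s]. *)
Fixpoint homotopy_rec (m : nat) F G s : 'F_2 :=
  if m is m'.+1 then
    if [pick v in s] is Some v then
      D (cone v F) G s + \sum_(x in s) homotopy_rec m' (cone v F) G (s :\ x)
    else 0
  else 0.

Definition homotopy F G s := homotopy_rec #|s| F G s.

Lemma homotopy_set0 F G : homotopy F G set0 = 0.
Proof. by rewrite /homotopy cards0. Qed.

(** The vertex depends on [s] alone, so one [v] serves all pairs [F], [G] at once. *)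
Lemma homotopyE s : s != set0 -> exists2 v, v \in s & forall F G,
  homotopy F G s = D (cone v F) G s + \sum_(x in s) homotopy (cone v F) G (s :\ x).
Proof.
move=> s0; rewrite /homotopy; case cs: #|s| => [|m].
  by move: s0; rewrite -cards_eq0 cs.
rewrite /=; case: pickP => [v vs|s_]; last first.
  by case/set0Pn: s0 => x; rewrite s_.
exists v => // F G; congr (_ + _); apply: eq_bigr => x xs.
suff -> : #|s :\ x| = m by [].
by move: cs; rewrite (cardsD1 x) xs add1n => -[].
Qed.

Lemma setD1_ind (P : {set T} -> Prop) :
  P set0 -> (forall s, s != set0 -> (forall x, x \in s -> P (s :\ x)) -> P s) -> forall s, P s.
Proof.
move=> P0 IH s; have [m] := ubnP #|s|; elim: m s => // m IHm s /ltnSE le_m.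
have [->//|s0] := eqVneq s set0; apply: (IH _ s0) => x xs; apply: IHm.
by rewrite (leq_trans _ le_m) // [X in (_ < X)%N](cardsD1 x) xs.
Qed.

(** As [v] lies in [s], joining with [v] keeps subsets of [s] inside [s]; hence H is carried like
    [D]. *)
Lemma homotopy_addl F1 F2 F3 G s : (forall A, A \subset s -> F3 A = F1 A + F2 A) ->
  homotopy F3 G s = homotopy F1 G s + homotopy F2 G s.
Proof.
elim/setD1_ind: s F1 F2 F3 => [|s s0 IH] F1 F2 F3 e; first by rewrite !homotopy_set0 addr0.
have [v vs E] := homotopyE s0.
have e' A : A \subset s -> cone v F3 A = cone v F1 A + cone v F2 A.
  by move=> As; rewrite /cone; case: ifP => _; rewrite ?addr0 // e // subUset sub1set vs.
rewrite !E (D_addl _ e') addrACA -big_split; congr (_ + _); apply: eq_bigr => x xs.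
by apply: IH => // A /subset_trans/(_ (subD1set _ _)); apply: e'.
Qed.

Lemma homotopy_0l F G s : (forall A, A \subset s -> F A = 0) -> homotopy F G s = 0.
Proof.
(* On subsets of [s], F = 0 = F + F, so additivity gives H = H + H = 0. *)
move=> F0; rewrite (@homotopy_addl F F F) ?addF2 // => A /F0 ->.
by rewrite addr0.
Qed.

Lemma homotopy_0r F G s : (forall A, A \subset s -> G A = 0) -> homotopy F G s = 0.
Proof.
elim/setD1_ind: s F => [|s s0 IH] F G0; first by rewrite homotopy_set0.
have [v vs ->] := homotopyE s0; rewrite D_0r // big1 ?addr0 // => x xs.
by apply: IH => // A /subset_trans/(_ (subD1set _ _)); apply: G0.
Qed.

(** This is D = Hd + dH. With c = D(s) + H(ds), contracting the left factor gives dH(s) = c + (h_v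
    (x) 1)(dc), and c is a cycle by induction on [s]. *)
Lemma homotopyP s :
  (forall t, t \subset s -> forall F G,
     D (dsum F) G t + D F (dsum G) t = \sum_(x in t) D F G (t :\ x)) ->
  forall F G, D F G s = \sum_(x in s) homotopy F G (s :\ x) +
                        (homotopy (dsum F) G s + homotopy F (dsum G) s).
Proof.
elim/setD1_ind: s => [|s s0 IH] chain F G.
  by rewrite D_set0 big_set0 !homotopy_set0 !addr0.
have [v vs E] := homotopyE s0.
pose F' := cone v F.
have eF A : cone v (dsum F) A = F A + dsum F' A.
  by rewrite -[in RHS](dsum_cone v F A) [RHS]addrC addrA addF2 add0r.
have hD : D (cone v (dsum F)) G s = D F G s + D (dsum F') G s by apply: D_addl.
have hH : \sum_(x in s) homotopy (cone v (dsum F)) G (s :\ x) =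
    \sum_(x in s) homotopy F G (s :\ x) + \sum_(x in s) homotopy (dsum F') G (s :\ x).
  by rewrite -big_split; apply: eq_bigr => x _; apply: homotopy_addl.
(* That c is a cycle, tested on F' (x) G. The vanishing sum H(dds) is inserted so that the induction
   hypothesis applies to each facet. *)
have cyc : D (dsum F') G s + D F' (dsum G) s =
    \sum_(x in s) homotopy (dsum F') G (s :\ x) + \sum_(x in s) homotopy F' (dsum G) (s :\ x).
  rewrite chain // -big_split /= -[RHS]add0r -[X in _ = X + _](sum_setD1D1 (homotopy F' G) s).
  rewrite -big_split /=.
  apply: eq_bigr => x xs; apply: IH => // t /subset_trans/(_ (subD1set _ _)).
  exact: chain.
rewrite !E hD hH -/F'.
move: cyc; set a := D F G s; set b := D (dsum F') G s; set c := D F' (dsum G) s.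
set h := \sum_(x in s) homotopy F G _; set h1 := \sum_(x in s) _; set h2 := \sum_(x in s) _.
move=> cyc.
have -> : a + b + (h + h1) + (c + h2) = a + h + ((b + c) + (h1 + h2)).
  by rewrite [a + b + _]addrACA -[LHS]addrA; congr (_ + _); rewrite addrACA.
by rewrite cyc addF2 addr0 addrCA addF2 addr0.
Qed.

End Carrier.

(** * The difference of two coproducts *)

Lemma locally_consistent_sub k (U : {set {set T}}) s t : t \subset s ->
  locally_consistent k U s -> locally_consistent k U t.
Proof.
move=> ts [Uk Us]; split=> // M a b c Mt; apply: Us.
exact: subset_trans Mt ts.
Qed.

Lemma Dsum_addl k (U : {set {set T}}) F1 F2 F3 G s :
  (forall A, A \subset s -> F3 A = F1 A + F2 A) ->
  Dsum k U F3 G s = Dsum k U F1 G s + Dsum k U F2 G s.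
Proof.
move=> e; rewrite /Dsum -big_split; apply: eq_bigr => L /andP[Ls _].
rewrite e ?mulrDl // subUset Ls; apply/subsetP=> a.
by rewrite !inE => /andP[/andP[]].
Qed.

Lemma Dsum_0r k (U : {set {set T}}) F G s :
  (forall A, A \subset s -> G A = 0) -> Dsum k U F G s = 0.
Proof.
move=> G0; apply: big1 => L /andP[Ls _].
by rewrite G0 ?mulr0 // subUset Ls subsetDl.
Qed.

Definition Dsum_diff k (U V : {set {set T}}) F G s : 'F_2 := Dsum k U F G s + Dsum k V F G s.

Lemma Dsum_diff_addl k (U V : {set {set T}}) F1 F2 F3 G s :
  (forall A, A \subset s -> F3 A = F1 A + F2 A) ->
  Dsum_diff k U V F3 G s = Dsum_diff k U V F1 G s + Dsum_diff k U V F2 G s.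
Proof. by move=> e; rewrite /Dsum_diff !(Dsum_addl _ _ _ e) addrACA. Qed.

Lemma Dsum_diff_0r k (U V : {set {set T}}) F G s :
  (forall A, A \subset s -> G A = 0) -> Dsum_diff k U V F G s = 0.
Proof. by move=> G0; rewrite /Dsum_diff !Dsum_0r // addr0. Qed.

Lemma Dsum_diff_set0 k (U V : {set {set T}}) F G : Dsum_diff k.+1 U V F G set0 = 0.
Proof. by rewrite /Dsum_diff !Dsum_set0 addr0. Qed.

(** The right-hand side of [Dsum_eq] involves only the empty consistent set, so it is common to [U]
    and [V] and cancels. *)
Lemma Dsum_diff_chain k (U V : {set {set T}}) F G s :
  locally_consistent k.+1 U s -> locally_consistent k.+1 V s ->
  Dsum_diff k.+1 U V (dsum F) G s + Dsum_diff k.+1 U V F (dsum G) s =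
  \sum_(x in s) Dsum_diff k.+1 U V F G (s :\ x).
Proof.
move=> Uc Vc; apply/esym/addF2_eq0; rewrite /Dsum_diff.
have regroup (a b c d e f : 'F_2) : a + b + (c + d + (e + f)) = a + c + e + (b + d + f).
  by rewrite [LHS]addrA [X in X + _ = _]addrACA [LHS]addrACA.
by rewrite big_split /= regroup (Dsum_eq F G Uc) (Dsum_eq F G Vc) addF2.
Qed.

End Homotopy.

(** * Passage to cohomology *)

Section Cohomology.
Variables (n : nat) (Sigma : scomplex n).
Implicit Types (u w : cochain Sigma) (U V : {set {set 'I_n.+1}}).

(** The degree q - 1 part of [w] has the same coboundary as [w] in degree q, and both coboundaries
    vanish elsewhere. This spares a degree count for the homotopy. *)
Lemma delta_in_Bp (q : int) w : delta Sigma w \in Cp Sigma q -> delta Sigma w \in Bp Sigma q.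
Proof.
move=> /memCp dwC.
pose w' : cochain Sigma :=
  lext (fun x : simplex Sigma =>
    (if verts x \in dimfaces Sigma (q - 1) then ev w (verts x) else 0) : ('F_2)^o).
have w'E s : ev w' s = if s \in dimfaces Sigma (q - 1) then ev w s else 0.
  have [/simplexP[x <-]|sS] := boolP (s \in faces Sigma); first exact: ev_lext.
  by rewrite !ev_notin // if_same.
apply/memv_imgP; exists w'; first by apply/memCp => s /negPf sq; rewrite w'E sq.
apply: cochainP => x; have xS := verts_in x.
have dimD1 y : y \in verts x -> (verts x :\ y \in dimfaces Sigma (q - 1)) =
    (verts x :\ y \in faces Sigma) && (verts x \in dimfaces Sigma q).
  move=> yx; rewrite !inE xS (cardsD1 y (verts x)) yx; congr (_ && _).
  by rewrite subrK PoszD addrC (inj_eq (addIr _)).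
have [xq|xq] := boolP (verts x \in dimfaces Sigma q); last first.
  rewrite dwC // ev_delta // /dsum big1 // => y yx.
  by rewrite w'E dimD1 // (negPf xq) andbF.
rewrite !ev_delta //; apply: eq_bigr => y yx; rewrite w'E dimD1 // xq andbT.
(* The facet of a vertex is empty, hence no simplex, and [ev] is 0 there. *)
by case: ifPn => // /ev_notin.
Qed.

Lemma cup_consistent_coboundary i U V (p : int) u :
  consistent Sigma i.+1 U -> consistent Sigma i.+1 V -> u \in Defs.Zp Sigma p ->
  cup i U u u - cup i V u u \in Bp Sigma (2 * p - i%:Z).
Proof.
move=> Uc Vc; rewrite memv_cap memv_ker => /andP[uC /eqP du].
pose D := Dsum_diff i.+1 U V.
pose w : cochain Sigma := lext (fun x : simplex Sigma =>
    homotopy D (ev u) (ev u) (verts x) : ('F_2)^o).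
have du0 (s A : {set _}) : s \in faces Sigma -> A \subset s -> dsum (ev u) A = 0.
  move=> sS As; have [->|A0] := eqVneq A set0; first by rewrite /dsum big_set0.
  by rewrite -ev_delta ?du ?ev_zero // (faces_closed sS).
have dw : cup i U u u - cup i V u u = delta Sigma w.
  apply: cochainP => x; have xS := verts_in x.
  have -> : - cup i V u u = cup i V u u by apply/esym/addc_eq0; rewrite subrr.
  transitivity (D (ev u) (ev u) (verts x)).
    by rewrite evD; congr (_ + _); exact: ev_cup.
  rewrite (ev_delta w xS).
  rewrite /D (homotopyP (@Dsum_diff_addl _ i.+1 U V) (@Dsum_diff_set0 _ i U V)); last first.
    move=> t ts F G; apply: Dsum_diff_chain; apply: locally_consistent_sub ts _;
      exact: consistent_local xS.
  (* Since [u] is a cocycle, both terms of dH vanish; what remains is the coboundary of [w]. *)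
  rewrite (homotopy_0l (@Dsum_diff_addl _ i.+1 U V)) => [|A]; last exact: du0.
  rewrite (homotopy_0r (@Dsum_diff_0r _ i.+1 U V)) => [|A]; last exact: du0.
  rewrite !addr0; apply: eq_bigr => y yx.
  have [->|nz] := eqVneq (verts x :\ y) set0; first by rewrite homotopy_set0 ev0.
  have /simplexP[z <-] : verts x :\ y \in faces Sigma.
    by rewrite (faces_closed xS) // subD1set.
  by rewrite ev_lext.
(* The degree is read off from the two cup products rather than from [w]. *)
rewrite dw delta_in_Bp // -dw.
by rewrite mulr_natl mulr2n rpredB // cup_Cp.
Qed.

End Cohomology.

Theorem theorem4p15 (n i : nat) (Sigma : scomplex n)
    (U V U' V' : {set {set 'I_n.+1}})
    (hU : consistent Sigma i.+1 U) (hV : consistent Sigma i.+1 V)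
    (hU' : consistent (full_complex n) i.+1 U')
    (hV' : consistent (full_complex n) i.+1 V')
    (eU : U = U' :&: dimfaces Sigma i.+1)
    (eV : V = V' :&: dimfaces Sigma i.+1)
    (p : int) (x : cohomology Sigma p) :
  Sq hU x = Sq hV x.
Proof.
(* Both squares use the same representative [repr x], so comparing them on one cocycle suffices. *)
apply/eqP; rewrite /Sq -Quotient.idealrBE inE linearB /=.
exact: cup_consistent_coboundary (subvsP _).
Qed.
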